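(* Let $n\ge 4$ be an integer and let $K=\{123,132,231,321\}$. There are exactly two equivalence classes of $S_n$ under $K$-equivalence: one consisting of the permutations equivalent to the identity $123\cdots n$, and one consisting of the permutations equivalent to the identity with $1$ and $2$ swapped, i.e. $2134\cdots n$.
   Context: Permutations in $S_n$ are written as words $\pi_1\pi_2\cdots\pi_n$ in one-line notation. The order permutation of a word $u$ of $c$ distinct positive integers is the unique $\sigma\in S_c$ with $\sigma_i<\sigma_j$ iff $u_i<u_j$. A replacement partition $K$ of $S_c$ is a set partition of $S_c$; it is denoted by listing its parts with the one-element parts (and outer brackets) omitted, so here $K$ is the set partition of $S_3$ whose only part of size greater than one is $\{123,132,231,321\}$. The $K$-equivalence on $S_n$ is the equivalence relation generated by: $\phi\equiv\psi$ whenever $\phi=aub$ and $\psi=avb$ (concatenations) for some possibly empty words $a,b$ and words $u,v$ of length $c$ (so $u,v$ occupy the same $c$ consecutive positions) such that the order permutations of $u$ and $v$ lie in the same part of $K$. *)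

(* Defs.v *)
From Stdlib Require Import Relation_Operators.
From mathcomp Require Import all_boot all_fingroup.
From mathcomp Require Import boolp.

Set Implicit Arguments.
Unset Strict Implicit.
Unset Printing Implicit Defensive.

(* 'S_n permutes {0, ..., n-1}; the one-line word uses the letters 1, ..., n. *)
Definition word (n : nat) (p : 'S_n) : seq nat :=
  [seq (p i : nat).+1 | i <- enum 'I_n].

Definition order_permutation (c : nat) (u : seq nat) (s : 'S_c) : Prop :=
  [/\ size u = c, uniq u
    & forall i j : 'I_c, (s i < s j) = (nth 0 u i < nth 0 u j)].

Definition replacement (c : nat) (K : {set {set 'S_c}}) (n : nat)
    (phi psi : 'S_n) : Prop :=
  exists a u v b : seq nat,
    [/\ word phi = a ++ u ++ b,
        word psi = a ++ v ++ b
      & exists s t : 'S_c,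
          [/\ order_permutation u s, order_permutation v t
            & exists2 B : {set 'S_c}, B \in K & (s \in B) && (t \in B)]].

Definition K_equiv (c : nat) (K : {set {set 'S_c}}) (n : nat) :
    'S_n -> 'S_n -> Prop :=
  clos_refl_sym_trans 'S_n (@replacement c K n).

Definition K_class (c : nat) (K : {set {set 'S_c}}) (n : nat) (p : 'S_n) :
    {set 'S_n} :=
  [set q | `[< K_equiv K p q >]].

Definition K_classes (c : nat) (K : {set {set 'S_c}}) (n : nat) :
    {set {set 'S_n}} :=
  equivalence_partition (fun p q : 'S_n => `[< K_equiv K p q >]) [set: 'S_n].

(* The replacement partition denoted by listing the single part P. *)
Definition single_part_partition (c : nat) (P : {set 'S_c}) : {set {set 'S_c}} :=
  P |: [set [set s] | s in ~: P].

Definition part_123_132_231_321 : {set 'S_3} :=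
  [set s | word s \in [:: [:: 1; 2; 3]; [:: 1; 3; 2]; [:: 2; 3; 1]; [:: 3; 2; 1]]].

Definition K_123_132_231_321 : {set {set 'S_3}} :=
  single_part_partition part_123_132_231_321.

Definition swap12 (n : nat) (n_gt1 : 1 < n) : 'S_n :=
  tperm (Ordinal (ltnW n_gt1)) (Ordinal n_gt1).

Lemma gt1_of_ge4 (n : nat) : 4 <= n -> 1 < n.
Proof. exact: leq_trans. Qed.

Lemma word_id (n : nat) : word (1%g : 'S_n) = iota 1 n.
Proof.
rewrite /word (eq_map (g := S \o val)); last by move=> i; rewrite perm1.
by rewrite map_comp val_enum_ord -[1]addn0 iotaDl.
Qed.

Lemma word_swap12 (n : nat) (n_gt1 : 1 < n) :
  word (swap12 n_gt1) = 2 :: 1 :: iota 3 (n - 2).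
Proof.
have -> : word (swap12 n_gt1) =
    [seq (if k == 0 then 2 else if k == 1 then 1 else k.+1) | k <- iota 0 n].
  rewrite -val_enum_ord -map_comp; apply: eq_map => i /=.
  rewrite permE /= -!val_eqE /=.
  by case: (val i == 0) => //; case: (val i == 1).
case: n n_gt1 => [|[|n]] // _.
rewrite /= subSS subSS subn0 -[3]/(1 + 2) iotaDl; congr [:: _, _ & _].
by apply/eq_in_map => k; rewrite mem_iota => /andP[]; case: k => [|[|k]].
Qed.

Lemma single_part_partitionP (c : nat) (P : {set 'S_c}) :
  P != set0 -> partition (single_part_partition P) [set: 'S_c].
Proof.
move=> P0; apply/and3P; split.
- apply/eqP/setP=> s; rewrite inE; apply/bigcupP.
  have [sP|sP] := boolP (s \in P); first by exists P; rewrite // !inE eqxx.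
  exists [set s]; last by rewrite inE.
  by rewrite !inE; apply/orP; right; apply/imsetP; exists s; rewrite // inE.
- apply/trivIsetP => A B; rewrite !inE.
  move=> /orP[/eqP->|/imsetP[s sP ->]] /orP[/eqP->|/imsetP[t tP ->]].
  + by rewrite eqxx.
  + by move=> _; rewrite disjoint_sym disjoints1; rewrite inE in tP.
  + by move=> _; rewrite disjoints1; rewrite inE in sP.
  + by move=> st; rewrite disjoints1 inE; apply: contraNneq st => ->.
- rewrite !inE negb_or eq_sym P0 /=; apply/imsetP => -[s _ /setP/(_ s)].
  by rewrite !inE eqxx.
Qed.

Lemma order_permutation_uniq (c : nat) (u : seq nat) (s t : 'S_c) :
  order_permutation u s -> order_permutation u t -> s = t.
Proof.
have val_count (r : 'S_c) i : r i = #|[set j | r j < r i]| :> nat.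
  have -> : [set j | r j < r i] = r @^-1: [set k : 'I_c | k < r i].
    by apply/setP => j; rewrite !inE.
  rewrite card_preimset; last exact: perm_inj.
  rewrite cardsE -sum1_card -[LHS]card_ord -sum1_card.
  by rewrite (big_ord_widen _ (fun=> 1) (ltnW (ltn_ord (r i)))).
move=> [_ _ su] [_ _ tu]; apply/permP => i; apply: val_inj => /=.
by rewrite (val_count s) (val_count t); apply: eq_card => j; rewrite !inE su tu.
Qed.

(* Main.v *)
Require Import Defs.
From mathcomp Require Import all_boot all_fingroup.
From mathcomp Require Import boolp.
From Stdlib Require Import Relation_Operators.

(** The four patterns 123, 132, 231, 321 are those whose smallest letter is not
    in the middle, so a replacement takes a window of three consecutive letters
    whose minimum is at an end and rearranges it so that the minimum is again at
    an end.  A window that contains the letter 1 then moves it by 0 or 2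
    positions: the parity of the position of 1 is an invariant
    ([K_equiv_odd_one]), which separates the identity from 2134...n.

    Conversely, let a word have distinct letters and minimum [m].  Jumps over two
    letters at a time bring [m] to the first or to the second position, according
    to the parity of its position, without disturbing the order of the other
    letters ([min_equiv_front]).  What remains is that the other letters can be
    permuted at will.

    If [m] is first ([min_first_perm]), argue by induction on the number of
    letters in the tail.  Let [k] be the minimum of the tail.  Inside the tail,
    [k] can be brought to the first or second place; since the two letters after
    [m] may be swapped, it can always be brought to the first place.  The letters
    after [k] are then permuted at will by the induction hypothesis, applied with
    [k] in the role of [m].

    If [m] is second and at least three other letters are present
    ([min_second_perm]), any move on the word of the other letters can still be
    carried out: the only obstruction is a window on the first three of them,
    which is interrupted by [m], and [m] can jump out of the way
    ([min_equiv_insert_second]).  Swapping the two letters that follow [m] again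
    allows [k] to be brought to the front of the word of the other letters, and
    the first case, with [k] as the leading minimum, permutes all that follows
    it.

    These moves are studied on words of natural numbers, where the tail of a word
    is again a word, and then transported to permutations
    ([min_equiv_K_equiv]). *)

Set Implicit Arguments.
Unset Strict Implicit.
Unset Printing Implicit Defensive.

(** * Moving the minimum of a window *)

(** The elementary moves on words: in a window of three letters that starts with
    its strict minimum [m], swap the two larger letters, or move [m] to the other
    end.  With their inverses they generate all rearrangements of a window that
    keep its minimum at an end. *)
Inductive min_move : seq nat -> seq nat -> Prop :=
| MinSwap a b m x y of m < x & m < y :
    min_move (a ++ [:: m; x; y] ++ b) (a ++ [:: m; y; x] ++ b)
| MinJump a b m x y of m < x & m < y :
    min_move (a ++ [:: m; x; y] ++ b) (a ++ [:: x; y; m] ++ b).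

(** The equivalence relation on words generated by [min_move]. *)
Definition min_equiv : seq nat -> seq nat -> Prop :=
  clos_refl_sym_trans (seq nat) min_move.

Local Notation "u ~~> v" := (min_equiv u v) (at level 70).

Lemma min_equiv_refl u : u ~~> u.
Proof. exact: rst_refl. Qed.

Lemma min_equiv_sym u v : u ~~> v -> v ~~> u.
Proof. exact: rst_sym. Qed.

Lemma min_equiv_trans v u w : u ~~> v -> v ~~> w -> u ~~> w.
Proof. exact: rst_trans. Qed.

Lemma min_equiv_swap m x y b : m < x -> m < y ->
  [:: m, x, y & b] ~~> [:: m, y, x & b].
Proof. by move=> mx my; apply: rst_step; exact: (@MinSwap [::]). Qed.

Lemma min_equiv_jump m x y b : m < x -> m < y ->
  [:: m, x, y & b] ~~> [:: x, y, m & b].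
Proof. by move=> mx my; apply: rst_step; exact: (@MinJump [::]). Qed.

Lemma min_equiv_cons h u v : u ~~> v -> h :: u ~~> h :: v.
Proof.
elim=> {u v} [u v uv|u|u v _|u v w _ uv _]; last 3 first.
- exact: min_equiv_refl.
- exact: min_equiv_sym.
- exact: min_equiv_trans.
apply: rst_step; case: uv => a b m x y mx my.
- exact: (@MinSwap (h :: a)).
- exact: (@MinJump (h :: a)).
Qed.

Lemma min_move_perm u v : min_move u v -> perm_eq u v.
Proof.
case=> a b m x y _ _; rewrite perm_cat2l perm_cat2r.
- by rewrite perm_cons (perm_catC [:: x] [:: y]).
- by rewrite (perm_catC [:: m] [:: x; y]).
Qed.

Lemma min_equiv_perm u v : u ~~> v -> perm_eq u v.
Proof.
elim=> {u v} [u v||u v _|u v w _ uv _]; first exact: min_move_perm.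
- exact: perm_refl.
- by rewrite perm_sym.
- exact: perm_trans.
Qed.

(** The word [w] with [m] inserted after its first letter; when [w] is empty,
    [m] is the only letter. *)
Definition insert_second m (w : seq nat) : seq nat :=
  if w is h :: t then [:: h, m & t] else [:: m].

(** Only the parity of the position of the minimum matters: repeated jumps bring
    it to one of the first two positions. *)
Lemma min_equiv_front m a b : all (ltn m) (a ++ b) ->
  a ++ m :: b ~~> (if odd (size a) then insert_second m (a ++ b)
                   else m :: a ++ b).
Proof.
(* A jump removes two letters in front of [m], hence a two-step induction. *)
pose P a := all (ltn m) (a ++ b) ->
  a ++ m :: b ~~> (if odd (size a) then insert_second m (a ++ b)
                   else m :: a ++ b).
suff : P a /\ forall x, P (x :: a) by case.
elim: a => [|y a [Pa Pya]]; first by split=> [|x] _; exact: min_equiv_refl.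
split=> [|x]; first exact: Pya.
move=> /= /and3P[mx my mab]; have := Pa mab; rewrite negbK.
case: a mab {P Pa Pya} => [|z a] /=.
  move=> _ _; exact/min_equiv_sym/min_equiv_jump.
case/andP=> mz mab; case: ifP => _ /(min_equiv_cons y) IH.
- apply: min_equiv_cons; apply: min_equiv_trans IH _.
  exact/min_equiv_sym/min_equiv_jump.
- apply: min_equiv_trans (min_equiv_cons x IH) _.
  exact/min_equiv_sym/min_equiv_jump.
Qed.

(** Moves on [u] survive the insertion of a smaller letter [m] in second
    position. *)
Lemma min_equiv_insert_second m u v :
    2 < size u -> all (ltn m) u -> u ~~> v ->
  insert_second m u ~~> insert_second m v.
Proof.
move=> + + uv; elim: uv => {u v} [u v uv|u|u v uv IH|u v w uv IHuv _ IHvw] su mu.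
- have mv : all (ltn m) v by rewrite -(perm_all _ (min_move_perm uv)).
  have sv : 2 < size v by rewrite -(perm_size (min_move_perm uv)).
  (* A window on the first three letters is interrupted by [m]; as at least
     three letters are present, [m] can jump to the right of that window. *)
  have jump w : 2 < size w -> all (ltn m) w ->
      insert_second m w ~~> take 3 w ++ m :: drop 3 w.
    case: w => [|h [|x [|y w]]] // _ /and4P[_ mx my _] /=; rewrite take0 drop0.
    exact/min_equiv_cons/min_equiv_jump.
  case: uv su mu sv mv => [[|h a] b k x y kx ky|[|h a] b k x y kx ky] su mu sv mv.
  + apply: min_equiv_trans (jump _ su mu) _.
    apply: min_equiv_trans (min_equiv_sym (jump _ sv mv)).
    by rewrite /= take0 drop0; exact: min_equiv_swap.
  + by do 2!apply: min_equiv_cons; apply: rst_step; exact: MinSwap.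
  + apply: min_equiv_trans (jump _ su mu) _.
    apply: min_equiv_trans (min_equiv_sym (jump _ sv mv)).
    by rewrite /= take0 drop0; exact: min_equiv_jump.
  + by do 2!apply: min_equiv_cons; apply: rst_step; exact: MinJump.
- exact: min_equiv_refl.
- have pvu := min_equiv_perm uv; apply/min_equiv_sym/IH.
  + by rewrite (perm_size pvu).
  + by rewrite (perm_all _ pvu).
- have puv := min_equiv_perm uv; apply: min_equiv_trans (IHuv su mu) _.
  by apply: IHvw; rewrite -?(perm_size puv) // -(perm_all _ puv).
Qed.

(** * Rearranging the letters other than the minimum *)

Lemma split_min (w : seq nat) : 0 < size w -> uniq w ->
  exists k a b, w = a ++ k :: b /\ all (ltn k) (a ++ b).
Proof.
move=> w0 uw; have exw : exists k, k \in w.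
  by case: w w0 {uw} => // k w _; exists k; rewrite mem_head.
case: (ex_minnP exw) => k kw kmin; exists k.
case/splitPr: w / kw uw kmin {w0 exw} => a b uw kmin; exists a, b; split=> //.
apply/allP => x xab; rewrite /= ltn_neqAle kmin ?andbT; last first.
  by move: xab; rewrite !mem_cat inE => /orP[->|->]; rewrite ?orbT.
have : uniq ([:: k] ++ a ++ b) by rewrite (perm_uniq (permEl (perm_catCA [:: k] a b))).
by case/andP => + _; apply: contraNneq => ->.
Qed.

(** After a leading letter [m] smaller than all the others, the minimum [k] of the
    other letters can be brought to the front of them. *)
Lemma min_first_reduce m x : 0 < size x -> uniq x -> all (ltn m) x ->
  exists k x', [/\ perm_eq x (k :: x'), all (ltn k) x'
                 & m :: x ~~> [:: m, k & x']].
Proof.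
move=> x0 ux; case: (split_min x0 ux) => k [a [b [-> kab]]] mx.
exists k, (a ++ b); split=> //; first by rewrite -cat1s perm_catCA.
have := min_equiv_cons m (min_equiv_front kab).
(* When [k] arrives in second place, after [h], it is exchanged with [h] by the
   window [m; h; k]. *)
case: ifP => // odda; first case: a odda kab mx => //= h a _ _.
case/andP=> mh; rewrite all_cat => /and3P[_ mk _] eqv.
by apply: min_equiv_trans eqv _; exact: min_equiv_swap.
Qed.

(** The same when [m] is the second letter of the word. *)
Lemma min_second_reduce m x : 2 < size x -> uniq x -> all (ltn m) x ->
  exists k x', [/\ perm_eq x (k :: x'), all (ltn k) x'
                 & insert_second m x ~~> insert_second m (k :: x')].
Proof.
move=> x2 ux mx; case: (split_min (ltnW (ltnW x2)) ux) => k [a [b [xE kab]]].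
have pxk : perm_eq x (k :: a ++ b) by rewrite xE -cat1s perm_catCA.
exists k, (a ++ b); split=> //.
have eqv := min_equiv_front kab; rewrite -xE in eqv.
have eqvm := min_equiv_insert_second x2 mx eqv.
move: eqv eqvm; case: ifP => // _ eqv eqvm; apply: min_equiv_trans eqvm _.
rewrite (perm_size pxk) in x2; rewrite (perm_all _ pxk) in mx.
case: (a ++ b) x2 mx kab {eqv pxk xE} => [|h [|t r]] //= _.
case/and4P => mk mh mt mr /and3P[kh kt kr].
(* From [h; m; k; t] to [h; m; t; k]; then [k] is the third of the other
   letters, and jumps over [h] and [t]. *)
apply: min_equiv_trans (min_equiv_cons h (min_equiv_swap r mk mt)) _.
apply: (@min_equiv_insert_second m [:: h, t, k & r] [:: k, h, t & r]) => //=.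
  by rewrite mh mt mk.
exact/min_equiv_sym/min_equiv_jump.
Qed.

Lemma perm_min_cons k k' (x y : seq nat) :
    all (ltn k) x -> all (ltn k') y -> perm_eq (k :: x) (k' :: y) ->
  k = k' /\ perm_eq x y.
Proof.
move=> kx ky pxy; suff kk : k = k' by split=> //; move: pxy; rewrite kk perm_cons.
have : k \in k' :: y by rewrite -(perm_mem pxy) mem_head.
rewrite inE => /predU1P[//|/(allP ky) /= k'k].
have : k' \in k :: x by rewrite (perm_mem pxy) mem_head.
rewrite inE => /predU1P[//|/(allP kx) /= kk'].
by move: (ltn_trans k'k kk'); rewrite ltnn.
Qed.

(** When the minimum is the first letter, the other letters can be permuted
    arbitrarily. *)
Lemma min_first_perm m x y : uniq x -> all (ltn m) x -> perm_eq x y ->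
  m :: x ~~> m :: y.
Proof.
have [n] := ubnP (size x); elim: n => // n IHn in m x y *.
rewrite ltnS => sx ux mx pxy.
have [x0|x0] := posnP (size x).
  move: pxy; rewrite (size0nil x0) perm_sym => /perm_nilP ->.
  exact: min_equiv_refl.
have [k [x' [pxk kx' eqx]]] := min_first_reduce x0 ux mx.
have uy : uniq y by rewrite -(perm_uniq pxy).
have my : all (ltn m) y by rewrite -(perm_all _ pxy).
have y0 : 0 < size y by rewrite -(perm_size pxy).
have [k' [y' [pyk ky' eqy]]] := min_first_reduce y0 uy my.
have [kk pxy'] : k = k' /\ perm_eq x' y'.
  apply: perm_min_cons => //.
  by apply: perm_trans pyk; apply: perm_trans pxy; rewrite perm_sym.
rewrite -kk in eqy; apply: min_equiv_trans eqx _.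
apply: min_equiv_trans (min_equiv_sym eqy); apply: min_equiv_cons.
apply: IHn => //; first by rewrite -ltnS; rewrite (perm_size pxk) in sx.
by move: ux; rewrite (perm_uniq pxk) => /andP[].
Qed.

(** When the minimum is the second letter, the other letters can be permuted
    arbitrarily, provided that there are at least three of them: the words
    [x; m; y] and [y; m; x] admit no move. *)
Lemma min_second_perm m x y : 2 < size x -> uniq x -> all (ltn m) x ->
  perm_eq x y -> insert_second m x ~~> insert_second m y.
Proof.
move=> x2 ux mx pxy; have [k [x' [pxk kx' eqx]]] := min_second_reduce x2 ux mx.
have uy : uniq y by rewrite -(perm_uniq pxy).
have my : all (ltn m) y by rewrite -(perm_all _ pxy).
have y2 : 2 < size y by rewrite -(perm_size pxy).
have [k' [y' [pyk ky' eqy]]] := min_second_reduce y2 uy my.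
have [kk pxy'] : k = k' /\ perm_eq x' y'.
  apply: perm_min_cons => //.
  by apply: perm_trans pyk; apply: perm_trans pxy; rewrite perm_sym.
rewrite -kk in eqy; apply: min_equiv_trans eqx _.
apply: min_equiv_trans (min_equiv_sym eqy).
apply: min_equiv_insert_second.
- by rewrite -(perm_size pxk).
- by rewrite -(perm_all _ pxk).
apply: min_first_perm => //.
by move: ux; rewrite (perm_uniq pxk) => /andP[].
Qed.

(** * Words of permutations *)

Lemma size_word n (p : 'S_n) : size (word p) = n.
Proof. by rewrite size_map size_enum_ord. Qed.

Lemma nth_word n (p : 'S_n) (i : 'I_n) : nth 0 (word p) i = (p i).+1.
Proof. by rewrite (nth_map i) ?size_enum_ord // nth_ord_enum. Qed.

Lemma word_inj n : injective (@word n).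
Proof.
move=> p q pq; apply/permP => i; apply/val_inj/succn_inj.
by rewrite -!nth_word pq.
Qed.

Lemma uniq_word n (p : 'S_n) : uniq (word p).
Proof.
rewrite map_inj_uniq ?enum_uniq // => i j [] /val_inj; exact: perm_inj.
Qed.

Lemma perm_word n (p : 'S_n) : perm_eq (word p) (iota 1 n).
Proof.
apply: uniq_perm (uniq_word p) (iota_uniq _ _) _.
apply: (uniq_min_size (uniq_word p) _ _).2; last by rewrite size_word size_iota.
by move=> _ /mapP[i _ ->]; rewrite mem_iota /= add1n ltnS.
Qed.

Lemma word_surj n (w : seq nat) : perm_eq w (iota 1 n) ->
  exists p : 'S_n, word p = w.
Proof.
move=> pw; have sw : size w = n by rewrite (perm_size pw) size_iota.
have uw : uniq w by rewrite (perm_uniq pw) iota_uniq.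
have wP (i : 'I_n) : 0 < nth 0 w i <= n.
  have : nth 0 w i \in iota 1 n by rewrite -(perm_mem pw) mem_nth ?sw.
  by rewrite mem_iota add1n ltnS.
have lt_f (i : 'I_n) : (nth 0 w i).-1 < n.
  by case/andP: (wP i) => w0 wn; rewrite prednK.
pose f i := Ordinal (lt_f i).
have f_inj : injective f.
  move=> i j [] eq_ij; apply: val_inj; apply/eqP => /=.
  rewrite -(nth_uniq 0 _ _ uw) ?sw //; apply/eqP.
  case/andP: (wP i) => /prednK <- _; case/andP: (wP j) => /prednK <- _.
  by rewrite eq_ij.
exists (perm f_inj).
apply: (@eq_from_nth _ 0); rewrite size_word ?sw // => i ltin.
rewrite (nth_word _ (Ordinal ltin)) permE /=.
by case/andP: (wP (Ordinal ltin)) => /prednK.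
Qed.

(** * Pattern replacements *)

Local Notation K := K_123_132_231_321.
Local Notation Kpart := part_123_132_231_321.

Lemma order_permutation_word (u : seq nat) (s : 'S_3) : size u = 3 -> uniq u ->
    (forall i j, i < 3 -> j < 3 ->
       (nth 0 (word s) i < nth 0 (word s) j) = (nth 0 u i < nth 0 u j)) ->
  order_permutation u s.
Proof.
by move=> su uu H; split=> // i j; rewrite -H // !nth_word ltnS.
Qed.

Lemma order_permutation_min_first m x y : m < x -> m < y -> x != y ->
  exists2 s : 'S_3, order_permutation [:: m; x; y] s & s \in Kpart.
Proof.
move=> mx my xy.
have [nxm nym] : x != m /\ y != m by rewrite !gtn_eqF.
have [nmx nmy] : (x < m) = false /\ (y < m) = false.
  by split; apply/negbTE; rewrite -leqNgt ltnW.
have uu : uniq [:: m; x; y] by rewrite /= !inE negb_or xy !(eq_sym m) nym nxm.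
have [ltxy|ltyx|eqxy] := ltngtP x y; last by rewrite eqxy eqxx in xy.
- have [s ws] : exists s : 'S_3, word s = [:: 1; 2; 3] by exact: word_surj.
  exists s; last by rewrite inE ws.
  apply: order_permutation_word => //; rewrite ws.
  move=> [|[|[|i]]] [|[|[|j]]] //= _ _;
    by rewrite ?ltnn ?mx ?my ?nmx ?nmy ?ltxy ?(ltnNge y) ?(ltnW ltxy).
- have [s ws] : exists s : 'S_3, word s = [:: 1; 3; 2] by exact: word_surj.
  exists s; last by rewrite inE ws.
  apply: order_permutation_word => //; rewrite ws.
  move=> [|[|[|i]]] [|[|[|j]]] //= _ _;
    by rewrite ?ltnn ?mx ?my ?nmx ?nmy ?ltyx ?(ltnNge x) ?(ltnW ltyx).
Qed.

Lemma order_permutation_min_last m x y : m < x -> m < y -> x != y ->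
  exists2 s : 'S_3, order_permutation [:: x; y; m] s & s \in Kpart.
Proof.
move=> mx my xy.
have [nxm nym] : x != m /\ y != m by rewrite !gtn_eqF.
have [nmx nmy] : (x < m) = false /\ (y < m) = false.
  by split; apply/negbTE; rewrite -leqNgt ltnW.
have uu : uniq [:: x; y; m] by rewrite /= !inE negb_or xy nym nxm.
have [ltxy|ltyx|eqxy] := ltngtP x y; last by rewrite eqxy eqxx in xy.
- have [s ws] : exists s : 'S_3, word s = [:: 2; 3; 1] by exact: word_surj.
  exists s; last by rewrite inE ws.
  apply: order_permutation_word => //; rewrite ws.
  move=> [|[|[|i]]] [|[|[|j]]] //= _ _;
    by rewrite ?ltnn ?mx ?my ?nmx ?nmy ?ltxy ?(ltnNge y) ?(ltnW ltxy).
- have [s ws] : exists s : 'S_3, word s = [:: 3; 2; 1] by exact: word_surj.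
  exists s; last by rewrite inE ws.
  apply: order_permutation_word => //; rewrite ws.
  move=> [|[|[|i]]] [|[|[|j]]] //= _ _;
    by rewrite ?ltnn ?mx ?my ?nmx ?nmy ?ltyx ?(ltnNge x) ?(ltnW ltyx).
Qed.

(** Words of permutations have distinct letters, so in a window the two letters
    above the minimum are comparable and every elementary move is a
    replacement. *)
Lemma min_move_replacement n (p q : 'S_n) :
  min_move (word p) (word q) -> replacement K p q.
Proof.
move=> pq; have := uniq_word p.
case: {-1}(word p) {-1}(word q) / pq (erefl (word p)) (erefl (word q)).
- move=> a b m x y mx my pE qE up; exists a, [:: m; x; y], [:: m; y; x], b.
  have xy : x != y.
    by apply: contraTneq up => ->; rewrite !cat_uniq /= !inE eqxx /= !andbF.
  split=> //; have [s su sP] := order_permutation_min_first mx my xy.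
  rewrite eq_sym in xy; have [t tv tP] := order_permutation_min_first my mx xy.
  by exists s, t; split=> //; exists Kpart; rewrite ?setU11 ?sP.
- move=> a b m x y mx my pE qE up; exists a, [:: m; x; y], [:: x; y; m], b.
  have xy : x != y.
    by apply: contraTneq up => ->; rewrite !cat_uniq /= !inE eqxx /= !andbF.
  split=> //; have [s su sP] := order_permutation_min_first mx my xy.
  have [t tv tP] := order_permutation_min_last mx my xy.
  by exists s, t; split=> //; exists Kpart; rewrite ?setU11 ?sP.
Qed.

Lemma min_equiv_K_equiv n (p q : 'S_n) : word p ~~> word q -> K_equiv K p q.
Proof.
move=> pq; have [u up] : exists u, u = word p by exists (word p).
have [v vq] : exists v, v = word q by exists (word q).
rewrite -up -vq in pq.
elim: pq p q up vq => {u v} [u v uv|u|u v _ IH|u v w uv IHuv _ IHvw] p q.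
- by move=> pE qE; apply: rst_step; apply: min_move_replacement; rewrite -pE -qE.
- by move=> -> /word_inj ->; apply: rst_refl.
- by move=> pE qE; apply: rst_sym; apply: IH.
- move=> pE qE; have [r rE] : exists r : 'S_n, word r = v.
    apply: word_surj; apply: perm_trans (perm_word p).
    by rewrite -pE perm_sym; exact: min_equiv_perm.
  by apply: (rst_trans _ _ _ r); [apply: IHuv | apply: IHvw].
Qed.

(** * The parity of the position of 1 *)

(** Parity of the position of the letter 1, positions being counted from 0: the
    identity gives [false]. *)
Definition odd_one n (p : 'S_n) := odd (index 1 (word p)).

(** If a window of positive letters contains 1, then 1 occurs where the order
    permutation is minimal. *)
Lemma order_permutation_index1 (c : nat) (u : seq nat) (s : 'S_c) (i : 'I_c) :
  order_permutation u s -> all (leq 1) u -> 1 \in u -> s i = 0 :> nat ->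
  index 1 u = i.
Proof.
move=> [su uu us] u1 u_1 si0.
have lt1 : index 1 u < c by rewrite -su index_mem.
have := us (Ordinal lt1) i; rewrite si0 ltn0 /= nth_index //.
move/esym/negbT; rewrite -leqNgt => nth_le1.
have /(all_nthP 0)/(_ i) := u1; rewrite su ltn_ord => /(_ isT) nth_ge1.
have nthi : nth 0 u i = 1 by apply/eqP; rewrite eqn_leq nth_le1.
by rewrite -nthi index_uniq ?su.
Qed.

(** The smallest letter of the four patterns is at an end of the window, that is
    at position 0 or 2. *)
Lemma odd_min_part (s : 'S_3) (i : 'I_3) : s \in Kpart -> s i = 0 :> nat -> ~~ odd i.
Proof.
rewrite !inE => sP si; have := nth_word s i; rewrite si.
by case: i {si} => -[|[|[|i]]] //= _; case/or4P: sP => /eqP ->.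
Qed.

Lemma replacement_odd_one n (p q : 'S_n) :
  replacement K p q -> odd_one p = odd_one q.
Proof.
case=> a [u [v [b [pE qE [s [t [su tv [B BK /andP[sB tB]]]]]]]]].
(* Both windows contain the same letters, so if 1 lies outside them, it keeps its
   position; otherwise its place in the window is read off the pattern. *)
have puv : perm_eq u v.
  rewrite -(perm_cat2r b) -(perm_cat2l a) -pE -qE.
  by apply: perm_trans (perm_word p) _; rewrite perm_sym perm_word.
rewrite /odd_one pE qE !index_cat (perm_mem puv) (perm_size puv).
case: ifP => // _; case: ifP => // v1; rewrite !oddD; congr (_ (+) _).
have word_ge1 (r : 'S_n) : all (leq 1) (word r).
  by apply/allP => _ /mapP[i _ ->].
have u_ge1 : all (leq 1) u by have := word_ge1 p; rewrite pE !all_cat => /and3P[].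
have v_ge1 : all (leq 1) v by have := word_ge1 q; rewrite qE !all_cat => /and3P[].
have idx (r : 'S_3) w : order_permutation w r -> all (leq 1) w -> 1 \in w ->
    exists2 i : 'I_3, r i = 0 :> nat & index 1 w = i.
  move=> rw w_ge1 w1; exists ((r^-1)%g ord0); first by rewrite permKV.
  by apply: order_permutation_index1 rw w_ge1 w1 _; rewrite permKV.
have u1 : 1 \in u by rewrite (perm_mem puv).
have [i si ->] := idx _ _ su u_ge1 u1; have [j tj ->] := idx _ _ tv v_ge1 v1.
move: BK; rewrite !inE => /predU1P[BP|/imsetP[r _ Br]].
- rewrite BP in sB tB.
  by rewrite (negbTE (odd_min_part sB si)) (negbTE (odd_min_part tB tj)).
- (* In a one-element part, both windows have the same pattern. *)
  move: sB tB; rewrite Br !inE => /eqP sr /eqP tr; congr odd; congr val.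
  by apply: (@perm_inj _ r); apply: val_inj; rewrite /= -{1}sr -tr si tj.
Qed.

Lemma K_equiv_odd_one n (p q : 'S_n) : K_equiv K p q -> odd_one p = odd_one q.
Proof. by elim=> {p q} // [p q|p q r _ -> _ ->//]; exact: replacement_odd_one. Qed.

Lemma odd_one_id n : odd_one (1%g : 'S_n) = false.
Proof. by rewrite /odd_one word_id; case: n. Qed.

Lemma odd_one_swap12 n (n_gt1 : 1 < n) : odd_one (swap12 n_gt1).
Proof. by rewrite /odd_one word_swap12. Qed.

(** Completeness of the invariant: the parity of the position of 1 decides which
    of the two representatives a permutation is equivalent to. *)
Lemma K_equiv_normal n (n_ge4 : 4 <= n) (p : 'S_n) :
  K_equiv K p (if odd_one p then swap12 (gt1_of_ge4 n_ge4) else 1%g).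
Proof.
apply: min_equiv_K_equiv; rewrite (fun_if (@word n)) word_swap12 word_id.
have pw := perm_word p; have uw := uniq_word p; rewrite /odd_one.
have w1 : 1 \in word p.
  by rewrite (perm_mem pw) mem_iota add1n /= ltnS; exact: leq_trans n_ge4.
case/splitPr: (word p) / w1 pw uw => a b.
have -> : iota 1 n = 1 :: 2 :: iota 3 (n - 2).
  by rewrite -{1}(subnKC (gt1_of_ge4 n_ge4)).
rewrite -cat1s perm_catCA perm_cons => pab; rewrite uniq_catCA => /andP[a1 uab].
have na1 : 1 \notin a by move: a1; rewrite mem_cat negb_or => /andP[].
rewrite index_cat (negbTE na1) /= addn0.
have mab : all (ltn 1) (a ++ b).
  rewrite (perm_all _ pab) /=; apply/allP => k; rewrite mem_iota => /andP[+ _].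
  exact: ltn_trans.
apply: min_equiv_trans (min_equiv_front mab) _; case: ifP => _.
- apply: (@min_second_perm 1 _ (2 :: iota 3 (n - 2))) => //.
  by rewrite (perm_size pab) /= size_iota ltnS ltn_subRL.
- exact: min_first_perm.
Qed.

(** * The two classes *)

Theorem proposition2p38 (n : nat) (n_ge4 : 4 <= n) :
  #|K_classes K_123_132_231_321 n| = 2 /\
  K_classes K_123_132_231_321 n =
    [set K_class K_123_132_231_321 (1%g : 'S_n);
         K_class K_123_132_231_321 (swap12 (gt1_of_ge4 n_ge4))].
Proof.
have equivE (p q : 'S_n) : `[< K_equiv K p q >] = (odd_one p == odd_one q).
  apply/asboolP/eqP => [|pq]; first exact: K_equiv_odd_one.
  apply: rst_trans (K_equiv_normal n_ge4 p) _; rewrite pq.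
  exact/rst_sym/K_equiv_normal.
have classE (p : 'S_n) : K_class K p = [set q | odd_one p == odd_one q].
  by apply/setP => q; rewrite !inE equivE.
have classesE : K_classes K n =
    [set K_class K (1%g : 'S_n); K_class K (swap12 (gt1_of_ge4 n_ge4))].
  have blockE (p : 'S_n) :
      [set q in [set: 'S_n] | `[< K_equiv K p q >]] = K_class K p.
    by apply/setP => q; rewrite !inE.
  apply/setP => B; rewrite !inE; apply/imsetP/orP => [[p _ ->]|].
    rewrite blockE !classE odd_one_id odd_one_swap12.
    by case: (odd_one p); [right | left].
  by case=> /eqP ->; [exists 1%g | exists (swap12 (gt1_of_ge4 n_ge4))];
    rewrite ?blockE.
split=> //; rewrite classesE cards2; suff -> : K_class K 1%g !=
  K_class K (swap12 (gt1_of_ge4 n_ge4)) by [].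
apply/eqP => /setP/(_ 1%g); rewrite !classE !inE eqxx.
by rewrite odd_one_id odd_one_swap12.
Qed.
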